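(* Let $\mathbf{H}=(H;0,+,\rightarrow)$ be a structure with a constant $0$ and binary operations $+$ and $\rightarrow$. Then $\mathbf{H}$ is a hoop if and only if $(H;0,+)$ is a commutative monoid and the following equations hold for all $x,y,z\in H$: \begin{enumerate} \item $x\rightarrow x=0$; \item $x\rightarrow 0=0$; \item $0\rightarrow x=x$; \item $(x+y)\rightarrow z=x\rightarrow(y\rightarrow z)$; \item $x+(x\rightarrow y)=y+(y\rightarrow x)$. \end{enumerate}
   Context: A pocrim is a structure $(M;0,+,\rightarrow)$ with a constant $0$ and binary operations $+,\rightarrow$ such that, writing $x\ge y$ as an abbreviation for $x\rightarrow y=0$: $(x+y)+z=x+(y+z)$, $x+y=y+x$, $x+0=x$; $\ge$ is reflexive, transitive and antisymmetric; $x\ge y$ implies $x+z\ge y+z$; $x\ge 0$; and $x+y\ge z$ iff $x\ge y\rightarrow z$. A hoop is a pocrim that is naturally ordered: whenever $x\ge y$ there is $z$ with $x=y+z$. *)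

(* Defs.v *)
From mathcomp Require Import ssreflect ssrfun.
From Stdlib Require Import Relation_Definitions.

Set Implicit Arguments.
Unset Strict Implicit.
Unset Printing Implicit Defensive.

Record pocrimSig : Type := PocrimSig {
  carrier :> Type;
  zero : carrier;
  add : carrier -> carrier -> carrier;
  imp : carrier -> carrier -> carrier
}.

Arguments zero {p}.
Arguments add {p} x y.
Arguments imp {p} x y.

Declare Scope pocrim_scope.
Delimit Scope pocrim_scope with P.
Bind Scope pocrim_scope with carrier.

Notation "0" := zero : pocrim_scope.
Notation "x + y" := (add x y) : pocrim_scope.
Notation "x ~> y" := (imp x y)
  (at level 55, right associativity) : pocrim_scope.

Local Open Scope pocrim_scope.

(* Vanishing of [x ~> y] means [x >= y], so [0] is the least element. *)
Definition geP (M : pocrimSig) (x y : M) : Prop := x ~> y = 0.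

Notation "x >= y" := (geP x y) : pocrim_scope.

Record is_comm_monoid (M : pocrimSig) : Prop := IsCommMonoid {
  cmon_addA : associative (@add M);
  cmon_addC : commutative (@add M);
  cmon_addx0 : right_id 0 (@add M)
}.

Record is_pocrim (M : pocrimSig) : Prop := IsPocrim {
  pocrim_monoid : is_comm_monoid M;
  pocrim_order : order M (@geP M);
  pocrim_mono : forall x y z : M, x >= y -> x + z >= y + z;
  pocrim_ge0 : forall x : M, x >= 0;
  pocrim_residuation : forall x y z : M, x + y >= z <-> x >= (y ~> z)
}.

Record is_hoop (M : pocrimSig) : Prop := IsHoop {
  hoop_pocrim : is_pocrim M;
  hoop_natural : forall x y : M, x >= y -> exists z : M, x = y + z
}.

(* Main.v *)
Require Import Defs.
From mathcomp Require Import ssreflect ssrfun.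
From Stdlib Require Import Relation_Definitions.

(** In a pocrim, residuation says that [y ~> z] is the least [w] with
    [w + y >= z].  The equation [(x + y) ~> z = x ~> (y ~> z)] then follows by
    comparing up-sets ([imp_curry]): both sides are least with
    [w + x + y >= z].  Natural order enters only in the last equation: it writes
    the upper bound [x + (x ~> y)] of [x] and [y] as a sum [y + z], and [z]
    dominates the residual [y ~> x] ([divisibility_ge]); symmetry in [x] and [y]
    and antisymmetry give the equality.

    Conversely, the last equation turns an inequality [x >= y] into a
    decomposition [x = y + (y ~> x)] ([ge_decomposition]), which is natural
    order with an explicit witness.  Substituting it gives antisymmetry at
    once, and transitivity and monotonicity because adding an element preserves
    lower bounds ([ge_addl]).  Residuation says that the two sides of the
    equation [(x + y) ~> z = x ~> (y ~> z)] vanish together. *)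

Local Open Scope pocrim_scope.

Section Pocrim.
Context {M : pocrimSig} (pM : is_pocrim M).

Lemma pocrim_ge_refl (x : M) : x >= x.
Proof. exact: (ord_refl _ _ (pocrim_order pM)). Qed.

(** The order analogue of the Yoneda lemma: up-sets separate elements. *)
Lemma eq_of_upper (a b : M) : (forall w : M, w >= a <-> w >= b) -> a = b.
Proof.
move=> eq_up; apply: (ord_antisym _ _ (pocrim_order pM)).
  by apply/eq_up; apply: pocrim_ge_refl.
by apply/eq_up; apply: pocrim_ge_refl.
Qed.

Lemma imp0x (x : M) : 0 ~> x = x.
Proof.
apply: eq_of_upper => w; have := pocrim_residuation pM w 0 x.
by rewrite (cmon_addx0 (pocrim_monoid pM)); exact: iff_sym.
Qed.

Lemma imp_curry (x y z : M) : (x + y) ~> z = x ~> (y ~> z).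
Proof.
apply: eq_of_upper => w.
apply: iff_trans (iff_sym (pocrim_residuation pM _ _ _)) _.
rewrite (cmon_addA (pocrim_monoid pM)).
by apply: iff_trans (pocrim_residuation pM _ _ _) (pocrim_residuation pM _ _ _).
Qed.

End Pocrim.

(** Half of the last equation.  By residuation [x + (x ~> y)] is above [y], so
    natural order writes it as [y + z]; as it is also above [x], residuation
    again gives [z >= y ~> x]. *)
Lemma divisibility_ge {M : pocrimSig} (hM : is_hoop M) (x y : M) :
  x + (x ~> y) >= y + (y ~> x).
Proof.
have pM := hoop_pocrim hM.
have addC := cmon_addC (pocrim_monoid pM).
have ge_y : x + (x ~> y) >= y.
  rewrite addC; apply/(pocrim_residuation pM); exact: pocrim_ge_refl.
have ge_x : x + (x ~> y) >= x.
  rewrite addC; apply/(pocrim_residuation pM).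
  rewrite (pocrim_ge_refl pM x); exact: pocrim_ge0.
have [z def_z] := hoop_natural hM ge_y.
rewrite def_z (addC y z) (addC y (y ~> x)); apply: (pocrim_mono pM).
by apply/(pocrim_residuation pM); rewrite addC -def_z.
Qed.

Section Equations.
Context {M : pocrimSig} (mM : is_comm_monoid M).
Context (impxx : forall x : M, x ~> x = 0) (impx0 : forall x : M, x ~> 0 = 0).
Context (curry : forall x y z : M, (x + y) ~> z = x ~> (y ~> z)).
Context (divisibility : forall x y : M, x + (x ~> y) = y + (y ~> x)).

Lemma ge_addl (w x y : M) : x >= y -> w + x >= y.
Proof. by rewrite /geP curry => ->. Qed.

Lemma ge_decomposition (x y : M) : x >= y -> x = y + (y ~> x).
Proof.
by move=> ge_xy; rewrite -divisibility (ge_xy : _ = _) (cmon_addx0 mM).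
Qed.

Lemma geP_order : order M (@geP M).
Proof.
split=> [x | x y z ge_xy ge_yz | x y ge_xy ge_yx]; first exact: impxx.
- rewrite (ge_decomposition _ _ ge_xy) (cmon_addC mM); exact: ge_addl.
- by rewrite (ge_decomposition _ _ ge_xy) (ge_yx : _ = _) (cmon_addx0 mM).
Qed.

Lemma ge_add2r (x y z : M) : x >= y -> x + z >= y + z.
Proof.
move=> /ge_decomposition ->.
rewrite (cmon_addC mM y) -(cmon_addA mM); apply: ge_addl; exact: impxx.
Qed.

Lemma hoop_of_equations : is_hoop M.
Proof.
split; last by move=> x y /ge_decomposition; exists (y ~> x).
split=> //; [exact: geP_order | exact: ge_add2r |].
by move=> x y z; rewrite /geP curry.
Qed.

End Equations.

Theorem theorem7 (H : pocrimSig) :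
  is_hoop H <->
  is_comm_monoid H /\
  (forall x : H, x ~> x = 0) /\
  (forall x : H, x ~> 0 = 0) /\
  (forall x : H, 0 ~> x = x) /\
  (forall x y z : H, (x + y) ~> z = x ~> (y ~> z)) /\
  (forall x y : H, x + (x ~> y) = y + (y ~> x)).
Proof.
split=> [hH | [mH [impxx [impx0 [_ [curry divisibility]]]]]]; last first.
  exact: hoop_of_equations.
have pH := hoop_pocrim hH.
split; first exact: pocrim_monoid.
split; first exact: pocrim_ge_refl.
split; first exact: pocrim_ge0.
split; first exact: imp0x.
split; first exact: imp_curry.
move=> x y; apply: (ord_antisym _ _ (pocrim_order pH)); exact: divisibility_ge.
Qed.
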